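(* Let $(\mathbb{K},[\cdot,\cdot])$ be a Krein space with fundamental symmetry $J$, and let $\{(W_i,v_i):i\in I\}$ be a $J$-fusion frame for $\mathbb{K}$, with index sets $I_\pm$ and $M_\pm=\overline{\sum_{i\in I_\pm}W_i}$. Then $\{(W_i,v_i):i\in I_\pm\}$ is a fusion frame for $(M_\pm,\pm[\cdot,\cdot])$, i.e. there exist constants $-\infty<B_-\le A_-<0<A_+\le B_+<\infty$ such that $$A_{\pm}[f,f]\le\sum_{i\in I_\pm}v_i^2\,\big|[\pi_{W_i}J(f),f]\big|\le B_\pm[f,f]\qquad\text{for every } f\in M_\pm .$$ (The statement is to be read for both choices of sign.)
   Context: $\langle f,g\rangle_J=[Jf,g]$ is the Hilbert space inner product of $\mathbb{K}$ and $\|\cdot\|_J$ its norm. For a closed subspace $W$, $\pi_W$ is the orthogonal projection onto $W$ with respect to $\langle\cdot,\cdot\rangle_J$. A subspace $W$ is $J$-non-negative if $[f,f]\ge 0$ for all $f\in W$; $J$-negative if $[f,f]<0$ for all nonzero $f\in W$; uniformly $J$-positive (resp. uniformly $J$-negative) if there is $\alpha>0$ with $[f,f]\ge\alpha\|f\|_J^2$ (resp. $-[f,f]\ge\alpha\|f\|_J^2$) for all $f\in W$. Maximality is with respect to inclusion. Families $\{(W_i,v_i):i\in I\}$ consist of closed subspaces $W_i$ of $\mathbb{K}$ with weights $v_i>0$, where each $W_i$ is either $J$-non-negative or $J$-negative. $I_+$ is the set of $i$ with $W_i$ $J$-non-negative, and $I_-$ the set of $i$ with $W_i\neq\{0\}$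 and $W_i$ $J$-negative, so that $I=I_+\sqcup I_-$. The family is Bessel if $\sum_{i}v_i^2\|\pi_{W_i}f\|_J^2\le B\|f\|_J^2$ for some $B<\infty$ and all $f\in\mathbb{K}$. Let $(\sum_{i\in I}\oplus W_i)_{\ell_2}$ be the Hilbert space of families $\{f_i\}$, $f_i\in W_i$, with $\sum\|f_i\|_J^2<\infty$. The synthesis operator is $T_{W,v}\{f_i\}=\sum_{i\in I}v_if_i$. Let $P_\pm$ be the orthogonal projection of this space onto $(\sum_{i\in I_\pm}\oplus W_i)_{\ell_2}$, and ${T_{W,v}}_\pm=T_{W,v}P_\pm$. The Bessel family is a $J$-fusion frame for $\mathbb{K}$ if the range $R({T_{W,v}}_+)$ is a maximal uniformly $J$-positive subspace of $\mathbb{K}$ and $R({T_{W,v}}_-)$ is a maximal uniformly $J$-negative subspace of $\mathbb{K}$. *)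

(* Defs.v *)
From HB Require Import structures.
From mathcomp Require Import all_boot all_order all_algebra finmap.
From mathcomp Require Import sesquilinear complex.
From mathcomp Require Import all_classical all_reals all_analysis.
From mathcomp Require summability.

Set Implicit Arguments.
Unset Strict Implicit.
Unset Printing Implicit Defensive.

Import Order.TTheory GRing.Theory Num.Theory.
Import numFieldNormedType.Exports.

Local Open Scope classical_set_scope.
Local Open Scope complex_scope.
Local Open Scope ring_scope.

Section LinearAlgebra.
Context {R : realType}.

Definition subspace {V : lmodType R[i]} (S : set V) : Prop :=
  S 0 /\ forall (a : R[i]) (f g : V), S f -> S g -> S (a *: f + g).

(* Equal to 0 by convention when there is no projection, which does not happen
   for closed subspaces of a Hilbert space. *)
Definition orth_proj {E : zmodType} (ip : E -> E -> R[i]) (S : set E) (x : E) : E :=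
  xget 0 [set p | S p /\ forall w, S w -> ip (x - p) w = 0].

(* The algebraic sum of the subspaces W i, i in A. *)
Definition sum_subspaces {V : lmodType R[i]} {I : choiceType} (A : set I)
    (W : I -> set V) : set V :=
  [set f | exists (F : {fset I}) (g : I -> V),
     (forall i, i \in F -> A i /\ W i (g i)) /\ f = \sum_(i <- F) g i].

Definition maximal_for {T : Type} (P : set T -> Prop) (S : set T) : Prop :=
  P S /\ forall S', P S' -> S `<=` S' -> S' = S.

End LinearAlgebra.

Section Krein.
Context {R : realType} {V : completeNormedModType R[i]}.

(* Antilinear in the second variable. *)
Variable br : {hermitian V for false & (@Num.conj R[i])}.
Variable J : V -> V.

Definition ipJ (f g : V) : R[i] := br (J f) g.

(* (V, br) is a Krein space and J = P+ - P- is the fundamental symmetry of a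
   fundamental decomposition V = Kp [+] Km, where the carrier V is already
   equipped with the J-norm.  On Kp and Km this norm is the one induced by br
   and - br, so that, V being complete, closedness of Kp and Km says that
   (Kp, br) and (Km, - br) are Hilbert spaces. *)
Definition krein_space_with_symmetry : Prop :=
  exists Kp Km : set V,
    [/\ subspace Kp /\ closed Kp, subspace Km /\ closed Km,
        (forall f, exists p m, [/\ Kp p, Km m & f = p + m])
          /\ Kp `&` Km = [set 0] &
        [/\ forall p m, Kp p -> Km m -> br p m = 0,
            forall p, Kp p -> p != 0 -> 0 < br p p,
            forall m, Km m -> m != 0 -> br m m < 0,
            forall p m, Kp p -> Km m -> J (p + m) = p - m &
            forall f, `|f| ^+ 2 = ipJ f f]].

Definition normJ (f : V) : R := complex.Re `|f|.

Definition piJ (S : set V) : V -> V := orth_proj ipJ S.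

(* The order of R[i] is partial: comparing with a real implies being real. *)
Definition J_nonneg (S : set V) : Prop := forall f, S f -> 0 <= br f f.

Definition J_negative (S : set V) : Prop :=
  forall f, S f -> f != 0 -> br f f < 0.

Definition unif_J_positive (S : set V) : Prop :=
  subspace S /\ exists2 alpha : R, 0 < alpha &
    forall f, S f -> alpha%:C * `|f| ^+ 2 <= br f f.

Definition unif_J_negative (S : set V) : Prop :=
  subspace S /\ exists2 alpha : R, 0 < alpha &
    forall f, S f -> alpha%:C * `|f| ^+ 2 <= - br f f.

Section Family.
Context {I : choiceType}.
Variables (W : I -> set V) (v : I -> R).

Definition Ipos : set I := [set i | J_nonneg (W i)].
Definition Ineg : set I := [set i | W i <> [set 0] /\ J_negative (W i)].

Definition bessel : Prop :=
  exists B : R, forall f : V,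
    (\esum_(i in [set: I]) (v i ^+ 2 * normJ (piJ (W i) f) ^+ 2)%:E
      <= (B * normJ f ^+ 2)%:E)%E.

(* The l2 direct sum of the W i, i in A, embedded by zero extension in the
   functions on the whole index set I. *)
Definition l2sum (A : set I) : set (I -> V) :=
  [set f | [/\ forall i, A i -> W i (f i), forall i, ~ A i -> f i = 0 &
     (\esum_(i in [set: I]) (normJ (f i) ^+ 2)%:E < +oo)%E]].

(* summability.sum is the limit of the net of finite partial sums. *)
Definition l2ip (f g : I -> V) : R[i] :=
  summability.sum (fun i => ipJ (f i) (g i) : R[i]^o).

Definition synthesis (f : I -> V) : V :=
  summability.sum (fun i => (v i)%:C *: f i).

Definition synthesis_on (A : set I) (f : I -> V) : V :=
  synthesis (orth_proj l2ip (l2sum A) f).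

Definition J_fusion_frame : Prop :=
  [/\ forall i, [/\ subspace (W i), closed (W i) & 0 < v i],
      forall i, J_nonneg (W i) \/ J_negative (W i),
      bessel,
      maximal_for unif_J_positive (synthesis_on Ipos @` l2sum [set: I]) &
      maximal_for unif_J_negative (synthesis_on Ineg @` l2sum [set: I])].

Definition Mpos : set V := closure (sum_subspaces Ipos W).
Definition Mneg : set V := closure (sum_subspaces Ineg W).

End Family.
End Krein.

(* Main.v *)
Require Import Defs.
From HB Require Import structures.
From mathcomp Require Import all_boot all_order all_algebra finmap.
From mathcomp Require Import sesquilinear complex.
From mathcomp Require Import all_classical all_reals all_analysis.
From mathcomp Require Import ring lra.
From mathcomp Require summability.

(* Since [[pi_W J f, f]] is the square of the J-norm of [pi_W J f], the upper
   bounds are the Bessel inequality together with uniform definiteness of the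
   range T of the synthesis operator; T is closed by maximality, since
   closures of uniformly definite subspaces are uniformly definite, and hence
   contains M.  For the lower bound write S(f) for the sum in the statement.
   If g in T is the synthesis of a square-summable family phi, then
   |[f, g]| <= S(f)^(1/2) |phi|.  If there were unit vectors f_n in T with
   S(f_n) -> 0 arbitrarily fast, this would give a pointwise estimate on T
   of the functionals [f_n, -], which the uniform boundedness principle makes
   uniform, contradicting |[f_n, f_n]| >= alpha. *)

Set Implicit Arguments.
Unset Strict Implicit.
Unset Printing Implicit Defensive.

Import Order.TTheory GRing.Theory Num.Theory.
Import numFieldNormedType.Exports.

Local Open Scope classical_set_scope.
Local Open Scope complex_scope.
Local Open Scope ring_scope.

Lemma exists_invS_lt (R : realType) (r : R) : 0 < r ->
  exists N, N.+1%:R^-1 < r.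
Proof.
move=> r0; exists (Num.truncn r^-1).
by rewrite -ltf_pV2 ?posrE ?invr_gt0// invrK truncnS_gt.
Qed.

(** * The norm as a real number, closures and Cauchy sequences *)

Section Norm.
Context {R : realType} {V : completeNormedModType R[i]}.
Implicit Types (f g h l : V) (S : set V).

Lemma normJE f : `|f| = (normJ f)%:C.
Proof. by rewrite /normJ RRe_real// normr_real. Qed.

Lemma normJ_ge0 f : 0 <= normJ f.
Proof. by rewrite -lecR -normJE normr_ge0. Qed.

Lemma normJ0 : normJ (0 : V) = 0.
Proof. by rewrite /normJ normr0 raddf0. Qed.

Lemma normJ_eq0 f : normJ f = 0 -> f = 0.
Proof. by move=> f0; apply/eqP; rewrite -normr_eq0 normJE f0. Qed.

Lemma normJD f g : normJ (f + g) <= normJ f + normJ g.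
Proof. by rewrite -lecR rmorphD /= -!normJE ler_normD. Qed.

Lemma normJN f : normJ (- f) = normJ f.
Proof. by rewrite /normJ normrN. Qed.

Lemma normJB f g : normJ (f - g) = normJ (g - f).
Proof. by rewrite -normJN opprB. Qed.

Lemma normJZ (t : R) f : normJ (t%:C *: f) = `|t| * normJ f.
Proof.
by apply: complexI; rewrite rmorphM /= -!normJE normrZ normc_def /= expr0n addr0 sqrtr_sqr.
Qed.

(** Comparability with 0 in [R[i]] kills the imaginary part, so the complex radii of balls can be
    replaced by real ones. *)
Lemma real_eps (e : R[i]) : 0 < e -> exists2 r : R, 0 < r & e = r%:C.
Proof.
case: e => a b; rewrite ltcE /= => /andP[/eqP -> a0]; exists a => //.
Qed.

Lemma closureP_normJ S l : closure S l <->
  forall e : R, 0 < e -> exists2 f, S f & normJ (l - f) < e.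
Proof.
split=> [Sl e e0|Sl B /nbhs_ballP[e /= e0 eB]].
  have [|f [Sf]] := Sl (ball l e%:C).
    by apply: nbhsx_ballx; rewrite ltcR.
  by rewrite -ball_normE /ball_ /= normJE ltcR; exists f.
have [r r0 er] := real_eps e0; have [f Sf lf] := Sl r r0.
exists f; split=> //; apply: eB.
by rewrite -ball_normE /ball_ /= normJE er ltcR.
Qed.

Lemma closed_normJ S l : closed S ->
  (forall e : R, 0 < e -> exists2 f, S f & normJ (l - f) < e) -> S l.
Proof. by move=> cS /closureP_normJ; apply: cS. Qed.

(** Completeness with an explicit modulus: a bound on all later differences also bounds the distance
    to the limit. *)
Lemma cauchy_seq_cvg (u : nat -> V) (b : nat -> R) :
  (forall e, 0 < e -> exists N, b N < e) ->
  (forall n m, (n <= m)%N -> normJ (u m - u n) <= b n) ->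
  exists l, forall n, normJ (l - u n) <= b n.
Proof.
move=> b0 ub; have : cvg (u @ \oo).
  apply/cauchy_cvgP/cauchyP => e e0; have [r r0 ->] := real_eps e0.
  have [N bN] := b0 _ r0; exists (u N); exists N => // m /= Nm.
  rewrite -ball_normE /ball_ /= normJE ltcR normJB.
  exact: le_lt_trans (ub _ _ Nm) _.
move=> /cvg_ex[l ul]; exists l => n; apply/ler_addgt0Pr => e e0.
have : \forall m \near \oo, normJ (l - u m) < e.
  have eC : 0 < e%:C :> R[i] by rewrite ltcR.
  move/cvgr_dist_lt: ul => /(_ _ eC).
  by apply: filterS => m; rewrite normJE ltcR.
move=> [N _ /(_ (maxn N n))/(_ (leq_maxl _ _)) le].
rewrite -(subrKA (u (maxn N n))) (le_trans (normJD _ _))// addrC.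
by rewrite lerD// ?ub ?leq_maxr// ltW.
Qed.

End Norm.

(** * Real parts of inner products and orthogonal projections *)

Section InnerProduct.
Context {R : realType} {V : completeNormedModType R[i]}.
Implicit Types (f g h l : V) (S : set V) (t : R).

(** The third clause ties the form to the norm that [V] already carries, and so yields positivity
    and definiteness. *)
Definition inner_product (ip : V -> V -> R[i]) : Prop :=
  [/\ forall a f g h, ip (a *: f + g) h = a * ip f h + ip g h,
      forall f g, ip f g = conjc (ip g f) &
      forall f, `|f| ^+ 2 = ip f f].

(** A real inner product with the same norm: estimates then take place in the ordered field [R]
    instead of the partially ordered [R[i]]. *)
Definition re_ip (ip : V -> V -> R[i]) f g : R := complex.Re (ip f g).

Context {ip : V -> V -> R[i]} (ipP : inner_product ip).

Local Notation rip := (re_ip ip).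

Lemma ipDl f g h : ip (f + g) h = ip f h + ip g h.
Proof. by case: ipP => l _ _; rewrite -[f]scale1r l mul1r scale1r. Qed.

Lemma ip0l h : ip 0 h = 0.
Proof. by apply/(addrI (ip 0 h)); rewrite -ipDl !addr0. Qed.

Lemma ipZl a f h : ip (a *: f) h = a * ip f h.
Proof. by case: ipP => l _ _; rewrite -[a *: f]addr0 l ip0l addr0. Qed.

Lemma ipC f g : ip f g = conjc (ip g f).
Proof. by case: ipP. Qed.

Lemma ip0r h : ip h 0 = 0.
Proof. by rewrite ipC ip0l rmorph0. Qed.

Lemma ripC f g : rip f g = rip g f.
Proof. by rewrite /re_ip ipC; case: (ip g f). Qed.

Lemma ripDl f g h : rip (f + g) h = rip f h + rip g h.
Proof. by rewrite /re_ip ipDl; case: (ip f h); case: (ip g h). Qed.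

Lemma ripZl t f h : rip (t%:C *: f) h = t * rip f h.
Proof. by rewrite /re_ip ipZl; case: (ip f h) => a b /=; rewrite mul0r subr0. Qed.

Lemma ripNl f h : rip (- f) h = - rip f h.
Proof. by rewrite -(scaleN1r f) -(rmorph1 (real_complex R)) -rmorphN ripZl mulN1r. Qed.

Lemma ripBl f g h : rip (f - g) h = rip f h - rip g h.
Proof. by rewrite ripDl ripNl. Qed.

Lemma ripDr f g h : rip h (f + g) = rip h f + rip h g.
Proof. by rewrite !(ripC h) ripDl. Qed.

Lemma ripZr t f h : rip h (t%:C *: f) = t * rip h f.
Proof. by rewrite !(ripC h) ripZl. Qed.

Lemma ripBr f g h : rip h (f - g) = rip h f - rip h g.
Proof. by rewrite !(ripC h) ripBl. Qed.

Lemma rip0r h : rip h 0 = 0.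
Proof. by rewrite /re_ip ip0r. Qed.

Lemma rip_sumr (I : Type) (s : seq I) (F : I -> V) h :
  rip h (\sum_(i <- s) F i) = \sum_(i <- s) rip h (F i).
Proof.
by elim/big_ind2: _ => [|x1 x2 y1 y2 <- <-|//]; rewrite ?rip0r ?ripDr.
Qed.

Lemma ip_norm f : ip f f = (normJ f ^+ 2)%:C.
Proof. by case: ipP => _ _ <-; rewrite normJE rmorphXn. Qed.

Lemma rip_norm f : rip f f = normJ f ^+ 2.
Proof. by rewrite /re_ip ip_norm. Qed.

Lemma normJ_sqrB f g :
  normJ (f - g) ^+ 2 = normJ f ^+ 2 - 2 * rip f g + normJ g ^+ 2.
Proof.
by rewrite -!rip_norm ripBl !ripBr (ripC g f) mulr_natl mulr2n; ring.
Qed.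

Lemma parallelogram f g :
  normJ (f - g) ^+ 2 = 2 * normJ f ^+ 2 + 2 * normJ g ^+ 2 - normJ (f + g) ^+ 2.
Proof. rewrite -!rip_norm ripBl !ripBr ripDl !ripDr (ripC g f); ring. Qed.

(** For [f] of norm one this is the non-negativity of the squared norm of [g - (rip f g)%:C *: f];
    scaling gives the rest. *)
Lemma rip_CauchySchwarz f g : `|rip f g| <= normJ f * normJ g.
Proof.
wlog f1 : f / normJ f = 1.
  move=> ih; have [/normJ_eq0 ->|f0] := eqVneq (normJ f) 0.
    by rewrite ripC rip0r normr0 normJ0 mul0r.
  have := ih ((normJ f)^-1%:C *: f); rewrite normJZ ripZl normrM.
  rewrite ger0_norm ?invr_ge0 ?normJ_ge0// mulVf// => /(_ erefl).
  by rewrite mul1r ler_pdivrMl// lt_neqAle eq_sym f0 normJ_ge0.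
rewrite f1 mul1r; rewrite -ler_sqr ?nnegrE ?normJ_ge0// real_normK ?num_real//.
have := sqr_ge0 (normJ (g - (rip f g)%:C *: f)).
rewrite normJ_sqrB ripZr (ripC g f) normJZ f1 mulr1 real_normK ?num_real//; lra.
Qed.

(** Testing against ['i *: w] as well as [w] recovers the imaginary part of [ip h w]. *)
Lemma rip_proj_ip S h : (forall a f, S f -> S (a *: f)) ->
  (forall w, S w -> rip h w = 0) -> forall w, S w -> ip h w = 0.
Proof.
move=> SZ h0 w Sw; have := h0 _ Sw; have := h0 _ (SZ 'i w Sw).
rewrite /re_ip (ipC _ ('i *: w)) ipZl (ipC w h).
case: (ip h w) => a b /= ; rewrite mul0r mul1r sub0r opprK => -> ->.
by [].
Qed.

Lemma subspaceZ S a f : Defs.subspace S -> S f -> S (a *: f).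
Proof. by move=> [S0 SD] Sf; rewrite -[_ *: _]addr0; exact: SD. Qed.

Lemma subspaceD S f g : Defs.subspace S -> S f -> S g -> S (f + g).
Proof. by move=> [S0 SD] Sf; rewrite -[f]scale1r; exact: SD. Qed.

Lemma subspaceB S f g : Defs.subspace S -> S f -> S g -> S (f - g).
Proof. by move=> [S0 SD] Sf Sg; rewrite addrC -scaleN1r; exact: SD. Qed.

(** A minimising sequence for the distance from [x] to [S] is Cauchy by the parallelogram law, and
    its limit lies in [S]. Orthogonality comes from the near-minimality of the terms, with an error
    that tends to zero. *)
Lemma exists_orth_proj S x : Defs.subspace S -> closed S ->
  exists p, S p /\ forall w, S w -> ip (x - p) w = 0.
Proof.
move=> subS cS.
pose D := [set normJ (x - w) ^+ 2 | w in S].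
have D0 : D !=set0 by exists (normJ (x - 0) ^+ 2); exists 0 => //; case: subS.
have Dlb : has_lbound D by exists 0 => _ [w _ <-]; exact: sqr_ge0.
have dP w : S w -> inf D <= normJ (x - w) ^+ 2.
  by move=> Sw; apply: ge_inf => //; exists w.
pose e n : R := n.+1%:R^-1.
have e0 n : 0 < e n by rewrite invr_gt0.
(* An excess of [e n ^+ 2] over the infimum gives the Cauchy modulus [2 * e n]. *)
have /choice[u uP] n : exists w, S w /\ normJ (x - w) ^+ 2 < inf D + e n ^+ 2.
  have [_ [w Sw <-] lt] := @inf_adherent _ D _ (exprn_gt0 2 (e0 n)) (conj D0 Dlb).
  by exists w.
have eM n m : (n <= m)%N -> e m <= e n.
  by move=> nm; rewrite /e lef_pV2 ?posrE// ler_nat.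
have elt r : 0 < r -> exists N, e N < r.
  exact: exists_invS_lt.
have [||p pP] := @cauchy_seq_cvg _ _ u (fun n => 2 * e n).
- move=> r r0; have [|N] := elt (r / 2); first by rewrite divr_gt0.
  by rewrite ltr_pdivlMr// mulrC; exists N.
- move=> n m nm; have [Sm um] := uP m; have [Sn un] := uP n.
  rewrite -ler_sqr ?nnegrE ?normJ_ge0 ?mulr_ge0 ?ltW//.
  have -> : u m - u n = (x - u n) - (x - u m).
    by rewrite opprB [RHS]addrC subrKA.
  rewrite parallelogram.
  (* The midpoint of [u n] and [u m] lies in [S], so its squared distance to [x] is at least the
     infimum. *)
  have -> : x - u n + (x - u m) = 2%:C *: (x - 2^-1%:C *: (u n + u m)).
    rewrite scalerBr scalerA -rmorphM mulfV// rmorph1 scale1r.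
    by rewrite rmorphD rmorph1 scalerDl scale1r opprD addrACA.
  rewrite normJZ ger0_norm// exprMn.
  have := dP _ (subspaceZ 2^-1%:C subS (subspaceD subS Sn Sm)).
  have : e m ^+ 2 <= e n ^+ 2 by rewrite ler_sqr ?nnegrE ?eM// ltW.
  move: un um; set X := normJ (x - _ *: _) ^+ 2; set A := normJ _ ^+ 2.
  set B := normJ _ ^+ 2; lra.
exists p; split.
  apply: closed_normJ => // r r0; have [|N lt] := elt (r / 2).
    by rewrite divr_gt0.
  exists (u N); first by case: (uP N).
  by rewrite (le_lt_trans (pP N))// mulrC -ltr_pdivlMr.
apply: rip_proj_ip => [a f|w Sw]; first exact: subspaceZ.
apply/eqP; rewrite -normr_le0; apply/ler_addgt0Pr => r r0; rewrite add0r.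
(* In units of [e n], the part [1 + normJ w ^+ 2] will come from perturbing [u n] along [w], and
   [2 * normJ w] from replacing [u n] by [p]. *)
have K0 : 0 < 1 + normJ w ^+ 2 + 2 * normJ w.
  by have := sqr_ge0 (normJ w); have := normJ_ge0 w; lra.
have [|n lt] := elt (r / (1 + normJ w ^+ 2 + 2 * normJ w)); first exact: divr_gt0.
rewrite ltr_pdivlMr// in lt.
have [Sn un] := uP n.
(* Compares [u n] with [u n + t%:C *: w]; the choices [t = e n] and [t = - e n] bound the inner
   product from both sides. *)
have var t : 2 * t * rip (x - u n) w <= e n ^+ 2 + t ^+ 2 * normJ w ^+ 2.
  have := dP _ (subspaceD subS Sn (subspaceZ t%:C subS Sw)).
  rewrite opprD addrA normJ_sqrB ripZr normJZ exprMn real_normK ?num_real//.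
  by move: un; lra.
have en := e0 n.
have : `|rip (x - u n) w| <= e n * (1 + normJ w ^+ 2).
  have := var (e n); have := var (- e n); rewrite sqrrN.
  have := mulr_ge0 (ltW (e0 n)) (mulr_ge0 (ltW (e0 n)) (sqr_ge0 (normJ w))).
  have := mulr_ge0 (ltW (e0 n)) (ltW (e0 n)).
  by rewrite ler_norml !expr2 => *; apply/andP; split; rewrite -(ler_pM2l (e0 n)); lra.
move=> H1; have -> : x - p = (x - u n) - (p - u n) by rewrite opprB subrKA.
rewrite (ripBl (x - u n)) (le_trans (ler_normB _ _))//.
have := le_trans (rip_CauchySchwarz (p - u n) w) (ler_wpM2r (normJ_ge0 w) (pP n)).
move: H1 lt; lra.
Qed.

Lemma orth_projP S x : Defs.subspace S -> closed S ->
  S (orth_proj ip S x) /\ forall w, S w -> ip (x - orth_proj ip S x) w = 0.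
Proof.
move=> subS cS; have [p pP] := exists_orth_proj x subS cS.
exact: (xgetPex 0 (ex_intro
  [set q | S q /\ forall w, S w -> ip (x - q) w = 0] p pP)).
Qed.

(** Uniqueness of the projection: the difference of the two sides lies in [S] and is orthogonal to
    [S], hence to itself. *)
Lemma orth_projZ S a x : Defs.subspace S -> closed S ->
  orth_proj ip S (a *: x) = a *: orth_proj ip S x.
Proof.
move=> subS cS; have [Sq ort] := orth_projP (a *: x) subS cS.
have [Sp ort'] := orth_projP x subS cS.
move: Sq ort Sp ort'; set q := orth_proj _ _ _; set p := orth_proj _ _ _.
move=> Sq ort Sp ort'.
have Sqp : S (a *: p - q) by apply: subspaceB => //; exact: subspaceZ.
have : ip (a *: p - q) (a *: p - q) = 0.
  have {1}-> : a *: p - q = (- a) *: (x - p) + (a *: x - q).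
    by rewrite scalerBr !scaleNr opprK (addrC (- _)) subrKA.
  by rewrite ipDl ipZl ort// ort'// mulr0 addr0.
rewrite ip_norm => -[] /eqP; rewrite expf_eq0 => /eqP/normJ_eq0/eqP.
by rewrite subr_eq0 => /eqP.
Qed.

Lemma rip_orth_proj S x w : Defs.subspace S -> closed S -> S w ->
  rip x w = rip (orth_proj ip S x) w.
Proof.
move=> subS cS Sw; have [_ /(_ _ Sw) xw] := orth_projP x subS cS.
by apply/eqP; rewrite -subr_eq0 -ripBl /re_ip xw.
Qed.

End InnerProduct.

(** * Uniform boundedness by a gliding hump *)

Section Geometry.
Context {R : realType} {V : completeNormedModType R[i]}.
Context {ip : V -> V -> R[i]} (ipP : inner_product ip).
Local Notation rip := (re_ip ip).

(* Sokal's gliding-hump proof of the uniform boundedness principle: if the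
   conclusion fails, signs can be chosen so that x = \sum_n +- q ^+ n *: f n,
   with q = alpha / 4, violates the pointwise bound. *)
Lemma uniform_lower_bound (S : set V) (L : V -> V) (P : R -> set V)
    (alpha : R) :
  Defs.subspace S -> closed S -> 0 < alpha ->
  (forall f, normJ (L f) = normJ f) ->
  (forall f, S f -> normJ f = 1 -> alpha <= `|rip (L f) f|) ->
  (forall x, S x -> exists C, forall e f, 0 < e -> normJ f = 1 -> P e f ->
     `|rip (L f) x| <= e * C) ->
  exists2 e, 0 < e & forall f, S f -> normJ f = 1 -> ~ P e f.
Proof.
move=> subS cS a0 Liso Lge Lle; apply: contrapT => nex.
have fex e : 0 < e -> exists f, [/\ S f, normJ f = 1 & P e f].
  move=> e0; apply: contrapT => nf; apply: nex; exists e => // f Sf f1 Pf.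
  by apply: nf; exists f.
(* Cauchy-Schwarz on a unit vector; it makes [q] at most 1/4. *)
have a1 : alpha <= 1.
  have [f [Sf f1 _]] := fex _ (@ltr01 R).
  have := rip_CauchySchwarz ipP (L f) f; rewrite Liso f1 mulr1.
  exact/le_trans/Lge.
pose q := alpha / 4.
have q0 : 0 < q by rewrite divr_gt0.
have q4 : q <= 4^-1 by rewrite /q; lra.
have qn0 n : 0 < q ^+ n by rewrite exprn_gt0.
have qn n : q ^+ n <= n.+1%:R^-1.
  elim: n => [|n ih]; first by rewrite expr0 invr1.
  rewrite exprS (le_trans (ler_pM (ltW q0) (ltW (qn0 n)) q4 ih))//.
  by rewrite -invfM lef_pV2 ?posrE ?mulr_gt0// -natrM ler_nat mulnS (@leq_add 2 n 4) ?leq_pmull.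
(* The extra factor [n.+1%:R^-1] makes the level negligible against the hump [q ^+ n * alpha],
   whatever the constant [C]. *)
have /choice[f fP] n : exists f, [/\ S f, normJ f = 1 & P (q ^+ n * n.+1%:R^-1) f].
  by apply: fex; rewrite mulr_gt0// invr_gt0.
pose step n x := if q ^+ n * alpha <= `|rip (L (f n)) (x + (q ^+ n)%:C *: f n)|
  then x + (q ^+ n)%:C *: f n else x - (q ^+ n)%:C *: f n.
pose fix x n := if n is m.+1 then step m (x m) else 0.
have Sx n : S (x n).
  elim: n => [|n ih] /=; first by case: subS.
  have [Sf _ _] := fP n; rewrite /step.
  by case: ifP => _; [apply: subspaceD|apply: subspaceB] => //; exact: subspaceZ.
(* With [u] the old value and [w] the increment, [2 |w| <= |u + w| + |u - w|], so one of the two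
   signs reaches [|w|]. *)
have hump n : q ^+ n * alpha <= `|rip (L (f n)) (x n.+1)|.
  rewrite /= /step; case: ifPn => //; rewrite -ltNge.
  have [Sf f1 _] := fP n.
  have := ler_wpM2l (ltW (qn0 n)) (Lge _ Sf f1).
  rewrite -{2}(gtr0_norm (qn0 n)) -normrM.
  rewrite (ripDr ipP) (ripBr ipP) (ripZr ipP).
  set w := _ * rip _ _ => H1; set u := rip _ (x n) => H2.
  have : `|w + w| <= `|u + w| + `|u - w|.
    by rewrite (_ : w + w = (u + w) - (u - w)) ?ler_normB//; ring.
  by rewrite -mulr2n -mulr_natl normrM ger0_norm//; lra.
have xstep n : normJ (x n.+1 - x n) = q ^+ n.
  have [_ f1 _] := fP n; rewrite /= /step; case: ifP => _.
    by rewrite addrC addKr normJZ f1 mulr1 gtr0_norm.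
  by rewrite addrC addKr normJN normJZ f1 mulr1 gtr0_norm.
(* A geometric tail of ratio at most 1/4, whence the factor [4 / 3]; the difference
   [q ^+ n - q ^+ m] is the form that suits induction. *)
have xb n m : (n <= m)%N -> normJ (x m - x n) <= 4 / 3 * q ^+ n.
  move=> nm; suff : normJ (x m - x n) <= 4 / 3 * (q ^+ n - q ^+ m).
    by have := qn0 m; lra.
  elim: m nm => [|m ih].
    by rewrite leqn0 => /eqP ->; rewrite !subrr normJ0 mulr0.
  rewrite leq_eqVlt => /predU1P[<-|nm]; first by rewrite !subrr normJ0 mulr0.
  rewrite -(subrKA (x m)) (le_trans (normJD _ _))// xstep exprS.
  have := ih nm; have := ler_wpM2r (ltW (qn0 m)) q4; lra.
have [|l lx] := cauchy_seq_cvg _ xb.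
  move=> e e0; have [|N lt] := @exists_invS_lt R (e / 2); first exact: divr_gt0.
  by exists N; have := le_lt_trans (qn N) lt; have := qn0 N; lra.
have Sl : S l.
  apply: closed_normJ => // e e0.
  have [|N lt] := @exists_invS_lt R (e / 2); first exact: divr_gt0.
  exists (x N) => //; rewrite (le_lt_trans (lx N))//.
  by have := le_lt_trans (qn N) lt; have := qn0 N; lra.
have [C CP] := Lle _ Sl.
have C1 : 0 < 1 + `|C| by rewrite ltr_wpDr.
(* After division by [q ^+ N], the pointwise bound stays below [alpha / 3] and the tail takes
   another [alpha / 3], too little for a hump of size [alpha]. *)
have [|N lt] := @exists_invS_lt R (alpha / 3 / (1 + `|C|)).
  by rewrite !divr_gt0.
have [Sf f1 Pf] := fP N.
have e0 : 0 < q ^+ N * N.+1%:R^-1 by rewrite mulr_gt0// invr_gt0.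
have up := CP _ _ e0 f1 Pf.
(* By the choice of [q], [4 / 3 * q ^+ N.+1] equals [q ^+ N * (alpha / 3)]. *)
have tail : `|rip (L (f N)) (l - x N.+1)| <= q ^+ N * (alpha / 3).
  rewrite (le_trans (rip_CauchySchwarz ipP _ _))// Liso f1 mul1r.
  by rewrite (le_trans (lx _))// exprS /q; lra.
have : q ^+ N * alpha <= q ^+ N * (alpha / 3) + q ^+ N * (N.+1%:R^-1 * C).
  rewrite (le_trans (hump N))//.
  have -> : x N.+1 = l - (l - x N.+1) by rewrite subKr.
  rewrite (ripBr ipP) (le_trans (ler_normB _ _))// addrC lerD//.
  by rewrite mulrA.
rewrite -mulrDr ler_pM2l//.
rewrite ltr_pdivlMr// in lt.
move: lt; have : N.+1%:R^-1 * C <= N.+1%:R^-1 * (1 + `|C|).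
  by rewrite ler_wpM2l// (le_trans (ler_norm C))// lerDr.
move: (_ * C) (_ * (1 + _)) => y z; lra.
Qed.

End Geometry.

(** * Extended sums and their finite subsums *)

Section Esum.
Context {R : realType} {I : choiceType}.
Implicit Types (A : set I) (a : I -> R) (F : {fset I}).

Lemma fsum_le_esum A a F : (forall i, i \in F -> A i) ->
  ((\sum_(i <- F) a i)%:E <= \esum_(i in A) (a i)%:E)%E.
Proof.
move=> FA; apply: esum_ge; exists [set` F]; first by split => //=.
by rewrite fsbig_finite//= set_fsetK sumEFin.
Qed.

Lemma esum_le_fsum A a (M : R) :
  (forall F, (forall i, i \in F -> A i) -> \sum_(i <- F) a i <= M) ->
  (\esum_(i in A) (a i)%:E <= M%:E)%E.
Proof.
move=> aM; apply: ge_ereal_sup => _ [X [finX XA] <-].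
rewrite fsbig_finite//= sumEFin lee_fin; apply: aM => i.
by rewrite in_fset_set// => /set_mem/XA.
Qed.

Lemma big_fset_split (M : nmodType) (F0 F : {fset I}) (x : I -> M) :
  (F0 `<=` F)%fset ->
  \sum_(i <- F) x i = \sum_(i <- F0) x i + \sum_(i <- (F `\` F0)%fset) x i.
Proof.
move=> F0F; rewrite (big_fsetID _ (mem F0)); congr (_ + _); apply: eq_fbigl => i.
  rewrite !inE /= andbC; apply/andP/idP => [[]//|iF0].
  by split=> //; exact: (fsubsetP F0F).
by rewrite !inE /= andbC.
Qed.

(** [F0] comes within [e] of the supremum of all finite sums, which leaves less than [e] outside
    it. *)
Lemma fsum_tail a M : (forall i, 0 <= a i) ->
  (forall F, \sum_(i <- F) a i <= M) ->
  forall e : R, 0 < e -> exists F0, forall F, (F0 `<=` F)%fset ->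
    \sum_(i <- (F `\` F0)%fset) a i < e.
Proof.
move=> a0 aM e e0; pose D := [set \sum_(i <- F) a i | F in [set: {fset I}]].
have Dsup : has_sup D.
  by split; [exists (\sum_(i <- fset0) a i); exists fset0|exists M => _ [F _ <-]].
have [_ [F0 _ <-] lt] := sup_adherent e0 Dsup.
exists F0 => F F0F.
have : \sum_(i <- F) a i <= sup D by apply: ub_le_sup; [case: Dsup|exists F].
have -> : \sum_(i <- F) a i = \sum_(i <- F0) a i + \sum_(i <- (F `\` F0)%fset) a i.
  exact: big_fset_split.
move: lt; lra.
Qed.

End Esum.

(** * Unordered sums as limits of nets *)

Section UnorderedSum.
Context {I : choiceType}.

#[local] Existing Instance summability.totally_filter.

Lemma partial_sumE (M : zmodType) (x : I -> M) (F : {fset I}) :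
  summability.partial_sum x F = \sum_(i <- F) x i.
Proof. by rewrite /summability.partial_sum big_seq_fsetE. Qed.

Lemma sum_fsupp (K : numFieldType) (E : normedModType K) (x : I -> E)
    (F : {fset I}) : (forall i, i \notin F -> x i = 0) ->
  summability.sum x = \sum_(i <- F) x i.
Proof.
move=> x0; apply: cvg_lim; first exact: norm_hausdorff.
apply: cvg_near_cst; exists F => // G /= FG.
by rewrite partial_sumE; apply/esym/big_fset_incl => // i _; exact: x0.
Qed.

(** The hypothesis is the Cauchy criterion for the net of partial sums; by completeness
    [summability.sum] is then a genuine limit and not a default value. *)
Lemma cauchy_sum_approx (R : realType) (V : completeNormedModType R[i])
    (x : I -> V) :
  (forall e : R, 0 < e -> exists F0, forall F, (F0 `<=` F)%fset ->
     normJ (\sum_(i <- (F `\` F0)%fset) x i) < e) ->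
  forall e : R, 0 < e ->
    exists F : {fset I}, normJ (summability.sum x - \sum_(i <- F) x i) < e.
Proof.
move=> xC; have : cvg (summability.partial_sum x @ summability.totally).
  apply/cauchy_cvgP/cauchyP => e e0; have [r r0 ->] := real_eps e0.
  have [F0 F0P] := xC _ r0.
  exists (summability.partial_sum x F0); exists F0 => // F /= F0F.
  rewrite -ball_normE /ball_ /= normJE ltcR normJB !partial_sumE.
  by rewrite (big_fset_split _ F0F) addrC addKr F0P.
move=> /cvg_ex[l xl] e e0.
have -> : summability.sum x = l by apply: cvg_lim xl; exact: norm_hausdorff.
have eC : 0 < e%:C :> R[i] by rewrite ltcR.
move/cvgr_dist_lt: xl => /(_ _ eC)[F _ /(_ F)]; rewrite /= => lF.
by exists F; rewrite -partial_sumE -ltcR -normJE lF.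
Qed.

End UnorderedSum.

(** * The fundamental symmetry and its Hilbert space structure *)

Section KreinSymmetry.
Context {R : realType} {V : completeNormedModType R[i]}.
Context {br : {hermitian V for false & (@Num.conj R[i])}} {J : V -> V}.
Context (hK : krein_space_with_symmetry br J).

Lemma hermitianC f g : br f g = conjc (br g f).
Proof. by rewrite hermC /= expr0 mul1r. Qed.

(** [J] is given as a bare map; linearity is read off from its formula on sums from [Kp] and
    [Km]. *)
Lemma symmetryP (a : R[i]) f g : J (a *: f + g) = a *: J f + J g.
Proof.
case: hK => Kp [Km [[sKp _] [sKm _] [dec _] [_ _ _ JE _]]].
have [p [m [Kp_p Km_m ->]]] := dec f; have [p' [m' [Kp_p' Km_m' ->]]] := dec g.
rewrite scalerDr addrACA !JE//; last 2 first.
- by apply: subspaceD => //; exact: subspaceZ.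
- by apply: subspaceD => //; exact: subspaceZ.
by rewrite scalerBr opprD addrACA.
Qed.

Lemma symmetryZ (a : R[i]) f : J (a *: f) = a *: J f.
Proof.
have J0 : J 0 = 0.
  by have := symmetryP 1 0 0; rewrite !scale1r addr0 => /esym/eqP; rewrite -subr_eq0 addrK => /eqP.
by rewrite -[a *: f]addr0 symmetryP J0 addr0.
Qed.

Lemma symmetryK f : J (J f) = f.
Proof.
case: hK => Kp [Km [_ [sKm _] [dec _] [_ _ _ JE _]]].
have [p [m [Kp_p Km_m ->]]] := dec f.
rewrite JE// JE ?opprK//.
by rewrite -scaleN1r; exact: subspaceZ.
Qed.

(** Cross terms vanish by orthogonality of [Kp] and [Km], and the sign on [Km] occurs twice. *)
Lemma symmetry_isometry f g : br (J f) (J g) = br f g.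
Proof.
case: hK => Kp [Km [_ _ [dec _] [ortho _ _ JE _]]].
have [p [m [Kp_p Km_m ->]]] := dec f; have [p' [m' [Kp_p' Km_m' ->]]] := dec g.
have pm' : br p m' = 0 by exact: ortho.
have mp' : br m p' = 0 by rewrite hermitianC ortho// rmorph0.
rewrite !JE//.
have -> : br (p - m) (p' - m') = br p p' - br p m' - (br m p' - br m m').
  by rewrite linearBl !linearBr.
have -> : br (p + m) (p' + m') = br p p' + br p m' + (br m p' + br m m').
  by rewrite linearDl !linearDr.
by rewrite pm' mp' subr0 sub0r addr0 add0r opprK.
Qed.

Lemma ipJ_symmetry f g : br f (J g) = br (J f) g.
Proof. by rewrite -{1}(symmetryK f) symmetry_isometry. Qed.

Lemma ipJP : inner_product (ipJ br J).
Proof.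
split=> [a f g h|f g|f]; first by rewrite /ipJ symmetryP linearPl.
- by rewrite /ipJ hermitianC ipJ_symmetry.
- by case: hK => Kp [Km [_ _ _ [_ _ _ _ ->]]].
Qed.

Lemma normJ_symmetry f : normJ (J f) = normJ f.
Proof.
apply/eqP; rewrite -(@eqrXn2 _ 2) ?normJ_ge0// -!(rip_norm ipJP).
by rewrite /re_ip /ipJ symmetry_isometry.
Qed.

Lemma rip_symmetry f g : re_ip (ipJ br J) (J f) g = complex.Re (br f g).
Proof. by rewrite /re_ip /ipJ symmetryK. Qed.

Lemma form_self_real f : br f f = (complex.Re (br f f))%:C.
Proof.
have := hermitianC f f; case: (br f f) => a b /= [b0].
by congr Complex; lra.
Qed.

(** With [p] the projection of [J f], [[p, f] = [J p, J f]] is the [J]-inner product of [p] and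
    [J f], and [J f - p] is orthogonal to [p]. *)
Lemma norm_form_proj (S : set V) f : Defs.subspace S -> closed S ->
  complex.Re `|br (piJ br J S (J f)) f| = normJ (piJ br J S (J f)) ^+ 2.
Proof.
move=> subS cS; have [Sp /(_ _ Sp) ort] := orth_projP ipJP (J f) subS cS.
set p := piJ _ _ _ _.
have -> : br p f = ipJ br J p p.
  rewrite -[f]symmetryK ipJ_symmetry -/(ipJ br J p (J f)).
  rewrite (ipC ipJP p (J f)) -{1}(subrK p (J f)) (ipDl ipJP) ort add0r.
  by rewrite -(ipC ipJP).
by rewrite (ip_norm ipJP) ger0_norm// ler0c sqr_ge0.
Qed.

End KreinSymmetry.

(** * Square-summable families and the synthesis operator *)

Section Family.
Context {R : realType} {V : completeNormedModType R[i]}.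
Context {br : {hermitian V for false & (@Num.conj R[i])}} {J : V -> V}.
Context (hK : krein_space_with_symmetry br J).
Context {I : choiceType} {W : I -> set V} {v : I -> R}.
Context (hW : forall i, [/\ Defs.subspace (W i), closed (W i) & 0 < v i]).
Implicit Types (A : set I) (f g : I -> V) (F : {fset I}).
Local Notation ip := (ipJ br J).
Local Notation rip := (re_ip (ipJ br J)).
Local Notation pi i := (piJ br J (W i)).

Definition zero_ext A f : I -> V := fun i => if `[< A i >] then f i else 0.

Definition single (i : I) (x : V) : I -> V := fun j => if j == i then x else 0.

Lemma l2sum_bound A f : l2sum W A f ->
  exists C, forall F, \sum_(i <- F) normJ (f i) ^+ 2 <= C.
Proof.
case=> _ _; set S := (\esum_(i in _) _)%E => Soo.
have S0 : (0 <= S)%E by apply: esum_ge0 => i _; rewrite lee_fin sqr_ge0.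
exists (fine S) => F; rewrite -lee_fin fineK; last by rewrite ge0_fin_numE.
exact: fsum_le_esum.
Qed.

Lemma l2sum_zero_ext A f : l2sum W [set: I] f -> l2sum W A (zero_ext A f).
Proof.
case=> Wf _ foo; split=> [i Ai|i nAi|].
- by rewrite /zero_ext asboolT//; exact: Wf.
- by rewrite /zero_ext asboolF.
apply: le_lt_trans foo; apply: le_esum => i _; rewrite lee_fin /zero_ext.
by case: ifP => // _; rewrite normJ0 expr0n sqr_ge0.
Qed.

Lemma l2sum_single A i x : A i -> W i x -> l2sum W A (single i x).
Proof.
move=> Ai Wx; split=> [j Aj|j nAj|].
- rewrite /single; case: eqP => [->//|_].
  by have [[]] := hW j.
- by rewrite /single; case: eqP => // ji; rewrite ji in nAj.
rewrite (@le_lt_trans _ _ (normJ x ^+ 2)%:E) ?ltry//.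
apply: esum_le_fsum => F _.
have [iF|iF] := boolP (i \in F).
  rewrite (big_fsetD1 i)//= big_seq big1 ?addr0 => [|j].
    by rewrite /single eqxx.
  by rewrite !inE /single => /andP[/negbTE -> _]; rewrite normJ0 expr0n.
rewrite big_seq big1 ?sqr_ge0// => j jF; rewrite /single.
by case: eqP => [ji|_]; [rewrite -ji jF in iF|rewrite normJ0 expr0n].
Qed.

Lemma l2ip_single f i x : l2ip br J f (single i x) = ip (f i) x.
Proof.
rewrite /l2ip (@sum_fsupp _ _ _ _ [fset i]%fset) ?big_seq_fset1.
  by rewrite /single eqxx.
move=> j; rewrite inE /single => /negbTE ->.
exact: (ip0r (ipJP hK)).
Qed.

(** The family [zero_ext A f] qualifies because each term of the inner product vanishes. Any other
    candidate agrees with it in each coordinate [i] of [A], by testing against families supported at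
    [i]. *)
Lemma l2_orth_proj A f : l2sum W [set: I] f ->
  orth_proj (l2ip br J) (l2sum W A) f = zero_ext A f.
Proof.
move=> l2f; have [Wf _ _] := l2f.
have ex : exists q, [set q | l2sum W A q /\
    forall w, l2sum W A w -> l2ip br J (f - q) w = 0] q.
  exists (zero_ext A f); split=> [|w [_ w0 _]]; first exact: l2sum_zero_ext.
  rewrite /l2ip (@sum_fsupp _ _ _ _ fset0) ?big_seq_fset0// => i _.
  have [Ai|nAi] := pselect (A i); last by rewrite w0// (ip0r (ipJP hK)).
  rewrite [(f - _) i](_ : _ = f i - zero_ext A f i)//.
  by rewrite /zero_ext asboolT// subrr (ip0l (ipJP hK)).
have [[Wp p0 _] ort] := xgetPex 0 ex; rewrite -/(orth_proj _ _ f) in Wp p0 ort *.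
set p := orth_proj _ _ _ in Wp p0 ort *; apply/funext => i; rewrite /zero_ext.
case: asboolP => Ai; last exact: p0.
have [subW _ _] := hW i.
have Wd := subspaceB subW (Wf i Logic.I) (Wp i Ai).
have := ort _ (l2sum_single Ai Wd); rewrite l2ip_single.
rewrite [(f - p) i](_ : _ = f i - p i)// (ip_norm (ipJP hK)).
by move=> [] /eqP; rewrite expf_eq0 => /eqP/normJ_eq0/eqP; rewrite subr_eq0 => /eqP.
Qed.

Lemma synthesis_onE A f : l2sum W [set: I] f ->
  synthesis_on br J W v A f = synthesis v (zero_ext A f).
Proof. by move=> l2f; rewrite /synthesis_on l2_orth_proj. Qed.

(** The preimage of [x] is the family with the single entry [(v i)^-1%:C *: x]. *)
Lemma sub_range_synthesis A i : A i ->
  W i `<=` synthesis_on br J W v A @` l2sum W [set: I].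
Proof.
move=> Ai x Wx; have [subW _ v0] := hW i.
have l2x : l2sum W [set: I] (single i ((v i)^-1%:C *: x)).
  by apply: l2sum_single => //; exact: subspaceZ.
exists (single i ((v i)^-1%:C *: x)) => //; rewrite synthesis_onE//.
rewrite /synthesis (@sum_fsupp _ _ _ _ [fset i]%fset).
  rewrite big_seq_fset1 /zero_ext asboolT// /single eqxx scalerA -rmorphM.
  by rewrite mulfV ?gt_eqF// rmorph1 scale1r.
move=> j; rewrite inE /zero_ext /single => /negbTE ->.
by rewrite if_same scaler0.
Qed.

(** * Synthesis under a Bessel bound *)

Context {B : R} (B0 : 0 < B).
Context (hB : forall x F,
  \sum_(i <- F) v i ^+ 2 * normJ (pi i x) ^+ 2 <= B * normJ x ^+ 2).

(* AM-GM, termwise. *)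
Lemma rip_synthesis_le F f x (e : R) : 0 < e -> (forall i, i \in F -> W i (f i)) ->
  `|rip x (\sum_(i <- F) (v i)%:C *: f i)| <=
    (e^-1 * \sum_(i <- F) v i ^+ 2 * normJ (pi i x) ^+ 2 +
     e * \sum_(i <- F) normJ (f i) ^+ 2) / 2.
Proof.
move=> e0 Wf; rewrite (rip_sumr (ipJP hK)) (le_trans (ler_norm_sum _ _ _))//.
rewrite !mulr_sumr -big_split/= mulr_suml.
rewrite big_seq [leRHS]big_seq; apply: ler_sum => i iF.
have [subW cW v0] := hW i.
rewrite (ripZr (ipJP hK)) normrM gtr0_norm//.
rewrite (rip_orth_proj (ipJP hK) _ subW cW (Wf _ iF)).
rewrite (le_trans (ler_wpM2l (ltW v0) (rip_CauchySchwarz (ipJP hK) _ _)))//.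
rewrite -/(piJ br J (W i) x).
set a := normJ _; set b := normJ _.
have := mulr_ge0 (ltW e0) (sqr_ge0 (e^-1 * (v i * a) - b)).
have -> : e * (e^-1 * (v i * a) - b) ^+ 2 =
    e^-1 * (v i ^+ 2 * a ^+ 2) + e * b ^+ 2 - 2 * (v i * (a * b)).
  by field; rewrite gt_eqF.
lra.
Qed.

(** The sum [x] is paired with itself, with parameter [e = B]; the Bessel bound turns the first term
    into half of [normJ x ^+ 2], which the left side absorbs. *)
Lemma normJ_synthesis_le F f : (forall i, i \in F -> W i (f i)) ->
  normJ (\sum_(i <- F) (v i)%:C *: f i) ^+ 2 <=
    B * \sum_(i <- F) normJ (f i) ^+ 2.
Proof.
move=> Wf; set x := \sum_(i <- F) _.
have := rip_synthesis_le x B0 Wf; rewrite (rip_norm (ipJP hK)).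
rewrite ger0_norm ?sqr_ge0//.
have := ler_wpM2l (ltW (_ : 0 < B^-1)) (hB x F).
rewrite invr_gt0 B0 mulKf ?gt_eqF// => /(_ erefl).
move: (_ * \sum_(i <- F) v i ^+ 2 * _) => y; lra.
Qed.

(** Reduces vectors of the range to finite sums. That [C] depends on [f] but not on the precision
    [e] is what a pointwise bound requires. *)
Lemma synthesis_on_approx A f : l2sum W [set: I] f ->
  exists2 C, 0 <= C & forall e : R, 0 < e -> exists F,
    [/\ forall i, i \in F -> A i, \sum_(i <- F) normJ (f i) ^+ 2 <= C &
     normJ (synthesis_on br J W v A f - \sum_(i <- F) (v i)%:C *: f i) < e].
Proof.
move=> l2f; have [Wf _ _] := l2f; have [C CP] := l2sum_bound l2f.
exists C => [|e e0].
  by have := CP fset0; rewrite big_seq_fset0.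
rewrite synthesis_onE//; set g := zero_ext A f.
have gf i : normJ (g i) ^+ 2 <= normJ (f i) ^+ 2.
  by rewrite /g /zero_ext; case: ifP => // _; rewrite normJ0 expr0n sqr_ge0.
have Wg i : W i (g i).
  rewrite /g /zero_ext; case: ifP => _; first exact: Wf.
  by have [[]] := hW i.
have gC F : \sum_(i <- F) normJ (g i) ^+ 2 <= C.
  by rewrite (le_trans _ (CP F))//; apply: ler_sum.
have [|F FP] := @cauchy_sum_approx _ _ _ (fun i => (v i)%:C *: g i) _ e e0.
  move=> r r0; have r2 : 0 < r ^+ 2 / B by rewrite divr_gt0// exprn_gt0.
  have [F0 F0P] := fsum_tail (fun i => sqr_ge0 (normJ (g i))) gC r2.
  exists F0 => F F0F; rewrite -ltr_sqr ?nnegrE ?normJ_ge0 ?(ltW r0)//.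
  rewrite (le_lt_trans (normJ_synthesis_le _))// mulrC -ltr_pdivlMr//.
  exact: F0P.
(* Terms of [g] outside [A] vanish, so cutting [F] down to [A] leaves the sum unchanged. *)
exists [fset i in F | `[< A i >]]%fset; split=> //.
  by move=> i; rewrite !inE => /andP[_ /asboolP].
rewrite /synthesis (_ : \sum_(i <- [fset _ | _ in _ & _]%fset) _ =
  \sum_(i <- F) (v i)%:C *: g i)//.
rewrite -big_fset_condE big_mkcond; apply: eq_bigr => i _.
by rewrite /g /zero_ext; case: ifP => // _; rewrite scaler0.
Qed.

(** * The lower frame bound on the range *)

Context {A : set I} {alpha : R} (alpha0 : 0 < alpha).
Local Notation T_range := (synthesis_on br J W v A @` l2sum W [set: I]).
Context (subT : Defs.subspace T_range) (closedT : closed T_range).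
Context (defT : forall x, T_range x ->
  alpha * normJ x ^+ 2 <= `|complex.Re (br x x)|).

(** Here [s] is any upper bound of the finite sums, which keeps the argument in [R]. *)
Lemma fusion_frame_lower_bound :
  exists2 c, 0 < c & forall x s, T_range x ->
    (forall F, (forall i, i \in F -> A i) ->
      \sum_(i <- F) v i ^+ 2 * normJ (pi i (J x)) ^+ 2 <= s) ->
    c * normJ x ^+ 2 <= s.
Proof.
(* The level is squared so that the pairing estimate with parameter [e] becomes linear in [e]. *)
pose P (e : R) x := forall F, (forall i, i \in F -> A i) ->
  \sum_(i <- F) v i ^+ 2 * normJ (pi i (J x)) ^+ 2 <= e ^+ 2.
have [|||e e0 eP] := @uniform_lower_bound _ _ _ (ipJP hK) _ J P alpha subT closedT alpha0.
- exact: (normJ_symmetry hK).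
- by move=> x Tx x1; have := defT Tx; rewrite x1 expr1n mulr1 (rip_symmetry hK).
- move=> _ [f l2f <-]; set x := synthesis_on _ _ _ _ _ _.
  have [C C0 CP] := synthesis_on_approx A l2f.
  have [Wf _ _] := l2f.
  (* The pairing estimate gives [(e^-1 * e ^+ 2 + e * C) / 2], at most [e * (1 + C)]. *)
  exists (1 + C) => e y e0 y1 Py; apply/ler_addgt0Pr => r r0.
  have [F [FA FC Fr]] := CP _ r0.
  rewrite -(subrK (\sum_(i <- F) (v i)%:C *: f i) x) (ripDr (ipJP hK)).
  rewrite (le_trans (ler_normD _ _))//.
  have := rip_CauchySchwarz (ipJP hK) (J y) (x - \sum_(i <- F) (v i)%:C *: f i).
  rewrite (normJ_symmetry hK) y1 mul1r.
  have := @rip_synthesis_le F f (J y) e e0 (fun i _ => Wf i Logic.I).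
  have := ler_wpM2l (ltW e0) FC.
  have ei0 : 0 < e^-1 by rewrite invr_gt0.
  have := ler_wpM2l (ltW ei0) (Py F FA).
  rewrite expr2 mulKf ?gt_eqF//.
  have := mulr_ge0 (ltW e0) C0.
  move: Fr; set X := _^-1 * _; set Y := e * \sum_(i <- F) _; lra.
(* Both sides are homogeneous of degree two, so a violation, once normalised, would be a unit vector
   satisfying [P e]. *)
exists (e ^+ 2); first exact: exprn_gt0.
move=> x s Tx xs; rewrite leNgt; apply/negP => lts.
have s0 : 0 <= s by have := xs fset0; rewrite big_seq_fset0; apply.
have x0 : normJ x != 0.
  by apply: contraTneq lts => ->; rewrite expr0n mulr0 -leNgt.
have nx : 0 < normJ x by rewrite lt_neqAle eq_sym x0 normJ_ge0.
apply: (eP ((normJ x)^-1%:C *: x)).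
- exact: subspaceZ.
- by rewrite normJZ gtr0_norm ?invr_gt0// mulVf.
move=> F FA.
have -> : \sum_(i <- F) v i ^+ 2 * normJ (pi i (J ((normJ x)^-1%:C *: x))) ^+ 2
   = (normJ x) ^- 2 * \sum_(i <- F) v i ^+ 2 * normJ (pi i (J x)) ^+ 2.
  rewrite mulr_sumr; apply: eq_bigr => i _; have [subW cW _] := hW i.
  rewrite (symmetryZ hK) /piJ (orth_projZ (ipJP hK))// normJZ exprMn.
  by rewrite real_normK ?num_real// exprVn mulrCA.
rewrite ler_pdivrMl ?exprn_gt0// mulrC (le_trans (xs _ FA))//.
exact: ltW.
Qed.

End Family.

(** * Uniformly definite subspaces and their closures *)

Section DefiniteSubspaces.
Context {R : realType} {V : completeNormedModType R[i]}.
Context {br : {hermitian V for false & (@Num.conj R[i])}} {J : V -> V}.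
Context (hK : krein_space_with_symmetry br J).
Local Notation rip := (re_ip (ipJ br J)).

Lemma subspace_closure (S : set V) :
  Defs.subspace S -> Defs.subspace (closure S).
Proof.
move=> subS; split; first by apply: subset_closure; case: subS.
move=> a f g /closureP_normJ Sf /closureP_normJ Sg.
apply/closureP_normJ => e e0; pose M := complex.Re `|a|.
have aM : `|a| = M%:C by rewrite /M RRe_real// normr_real.
have M0 : 0 <= M by rewrite -ler0c -aM.
(* The divisor [1 + M] instead of [M] covers the case [a = 0]. *)
have [|f' Sf' ff'] := Sf (e / 2 / (1 + M)).
  by rewrite !divr_gt0// ltr_wpDr.
have [|g' Sg' gg'] := Sg (e / 2); first by rewrite divr_gt0.
exists (a *: f' + g'); first by case: subS => _; apply.
rewrite opprD addrACA -scalerBr (le_lt_trans (normJD _ _))//.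
have -> : normJ (a *: (f - f')) = M * normJ (f - f').
  by apply: complexI; rewrite rmorphM /= -!normJE normrZ aM.
rewrite ltr_pdivlMr ?ltr_wpDr// in ff'.
have := normJ_ge0 (f - f'); move: ff' gg'; lra.
Qed.

Lemma form_self_le f : `|complex.Re (br f f)| <= normJ f ^+ 2.
Proof.
rewrite -(rip_symmetry hK) (le_trans (rip_CauchySchwarz (ipJP hK) _ _))//.
by rewrite (normJ_symmetry hK) expr2.
Qed.

(** The inequality passes to limits by continuity of the form in the [J]-norm; the sign [s] treats
    positive and negative subspaces at once. *)
Lemma form_self_ge_closure (S : set V) (s alpha : R) : 0 < alpha -> `|s| = 1 ->
  (forall f, S f -> alpha * normJ f ^+ 2 <= s * complex.Re (br f f)) ->
  forall f, closure S f -> alpha * normJ f ^+ 2 <= s * complex.Re (br f f).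
Proof.
move=> a0 s1 hS f /closureP_normJ Sf; apply/ler_addgt0Pr => e e0.
(* Passing from [g = f - d] back to [f] costs at most [K * normJ d], once [normJ d < 1] bounds the
   square of [normJ d] by [normJ d]. *)
pose K := (1 + alpha) * (2 * normJ f + 1).
have nf := normJ_ge0 f.
have K0 : 0 < K by rewrite mulr_gt0//; lra.
have [|g Sg fg] := Sf (Num.min 1 (e / K)).
  by rewrite lt_min ltr01 divr_gt0.
move: fg; rewrite lt_min ltr_pdivlMr// => /andP[d1 dK].
set d := f - g in d1 dK; have gE : g = f - d by rewrite subKr.
clearbody d; have d0 := normJ_ge0 d.
have := hS _ Sg; rewrite -!(rip_symmetry hK) gE (normJ_sqrB (ipJP hK)).
have -> : J (f - d) = J f - J d.
  by rewrite addrC -scaleN1r (symmetryP hK) scaleN1r addrC.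
rewrite (ripBl (ipJP hK)) !(ripBr (ipJP hK)).
have cs := rip_CauchySchwarz (ipJP hK).
have := cs (J d) d; have := cs (J d) f; have := cs (J f) d.
rewrite !(normJ_symmetry hK) !ler_norml.
move=> /andP[A1 A2] /andP[B1 B2] /andP[C1 C2].
have fd : rip f d <= normJ f * normJ d := le_trans (ler_norm _) (cs f d).
have {fd} := ler_wpM2l (ltW a0) fd.
have := ler_wpM2l d0 (ltW d1).
have := mulr_ge0 (ltW a0) (mulr_ge0 d0 d0); have := mulr_ge0 (ltW a0) d0.
move: dK; rewrite /K !expr2 mulr1.
have /orP[/eqP ->|/eqP ->] : (s == 1) || (s == -1).
  by rewrite -eqr_norm2 s1 normr1.
- by rewrite !mul1r; lra.
- by rewrite !mulN1r; lra.
Qed.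

(** The factor [1] is kept so that both signs are instances of one shape. *)
Lemma unif_J_positiveP (S : set V) : unif_J_positive br S <->
  Defs.subspace S /\ exists2 alpha : R, 0 < alpha &
    forall f, S f -> alpha * normJ f ^+ 2 <= 1 * complex.Re (br f f).
Proof.
by split=> -[subS [a a0 aP]]; split=> //; exists a => // f /aP;
  rewrite form_self_real normJE -rmorphXn -rmorphM lecR mul1r.
Qed.

Lemma unif_J_negativeP (S : set V) : unif_J_negative br S <->
  Defs.subspace S /\ exists2 alpha : R, 0 < alpha &
    forall f, S f -> alpha * normJ f ^+ 2 <= -1 * complex.Re (br f f).
Proof.
by split=> -[subS [a a0 aP]]; split=> //; exists a => // f /aP;
  rewrite form_self_real normJE -rmorphXn -rmorphM -rmorphN lecR mulN1r.
Qed.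

(** The closure of [S] satisfies [P] with the same [alpha], so maximality identifies it with [S]. *)
Lemma maximal_uniform (P : set V -> Prop) (S : set V) (s : R) : `|s| = 1 ->
  (forall S', P S' <-> Defs.subspace S' /\ exists2 alpha : R, 0 < alpha &
    forall f, S' f -> alpha * normJ f ^+ 2 <= s * complex.Re (br f f)) ->
  maximal_for P S ->
  [/\ Defs.subspace S, closed S & exists2 alpha : R, 0 < alpha &
    forall f, S f -> alpha * normJ f ^+ 2 <= s * complex.Re (br f f)].
Proof.
move=> s1 PE [/PE[subS [a a0 aP]] maxS]; split=> //; last by exists a.
rewrite closure_id; apply/esym/maxS; last exact: subset_closure.
apply/PE; split; first exact: subspace_closure.
by exists a => // f; exact: (form_self_ge_closure a0 s1 aP).
Qed.

End DefiniteSubspaces.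

(** * Frame bounds on the closed span *)

Section FrameBounds.
Context {R : realType} {V : completeNormedModType R[i]}.
Context {br : {hermitian V for false & (@Num.conj R[i])}} {J : V -> V}.
Context (hK : krein_space_with_symmetry br J).
Context {I : choiceType} {W : I -> set V} {v : I -> R}.
Context (hW : forall i, [/\ Defs.subspace (W i), closed (W i) & 0 < v i]).

Lemma closure_sum_subspaces_sub (A : set I) (S : set V) :
  Defs.subspace S -> closed S -> (forall i, A i -> W i `<=` S) ->
  closure (sum_subspaces A W) `<=` S.
Proof.
move=> subS clS WS; rewrite [X in _ `<=` X](closure_id S).1//.
apply: closure_subset => _ [F [g [FW ->]]].
rewrite big_seq; elim/big_ind: _ => [|x y|i /FW[Ai]]; first by case: subS.
  exact: subspaceD.
exact: WS.
Qed.

Lemma fusion_frame_bounds (A : set I) (s : R) : `|s| = 1 ->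
  bessel br J W v ->
  let T := synthesis_on br J W v A @` l2sum W [set: I] in
  Defs.subspace T -> closed T ->
  (exists2 alpha : R, 0 < alpha &
    forall f, T f -> alpha * normJ f ^+ 2 <= s * complex.Re (br f f)) ->
  exists c C : R, [/\ 0 < c, c <= C &
    forall f : V, closure (sum_subspaces A W) f ->
      ((c * (s * complex.Re (br f f)))%:E
        <= \esum_(i in A)
             (v i ^+ 2 * complex.Re `|br (piJ br J (W i) (J f)) f|)%:E
        <= (C * (s * complex.Re (br f f)))%:E)%E].
Proof.
move=> s1 [B0 hB0] T subT closedT [a a0 aP].
(* Nothing forces the given Bessel constant to be positive. *)
pose B := `|B0| + 1; have B_gt0 : 0 < B by rewrite ltr_wpDl.
have hB x (F : {fset I}) : \sum_(i <- F) v i ^+ 2 * normJ (piJ br J (W i) x) ^+ 2 <=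
    B * normJ x ^+ 2.
  rewrite -lee_fin; apply: le_trans (le_trans (hB0 x) _).
    exact: fsum_le_esum.
  rewrite lee_fin ler_wpM2r ?sqr_ge0//.
  by rewrite (le_trans (ler_norm _))// lerDl.
have absT x : T x -> a * normJ x ^+ 2 <= `|complex.Re (br x x)|.
  by move=> /aP/le_trans; apply; rewrite (le_trans (ler_norm _))// normrM s1 mul1r.
have [c c0 cP] := fusion_frame_lower_bound hK hW B_gt0 hB a0 subT closedT absT.
(* The maximum secures [c <= C] even when the closed span is [{0}] and the inequalities do not
   compare the constants. *)
exists c, (Num.max c (B / a)); split=> //; first by rewrite le_max lexx.
move=> f Mf.
have Tf : T f.
  by apply: closure_sum_subspaces_sub Mf => // i; exact: sub_range_synthesis.
have -> : \esum_(i in A) (v i ^+ 2 * complex.Re `|br (piJ br J (W i) (J f)) f|)%:E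
    = \esum_(i in A) (v i ^+ 2 * normJ (piJ br J (W i) (J f)) ^+ 2)%:E.
  by apply: eq_esum => i _; have [subW cW _] := hW i; rewrite norm_form_proj.
set S := \esum_(i in A) _.
have S0 : (0 <= S)%E.
  by apply: esum_ge0 => i _; rewrite lee_fin mulr_ge0 ?sqr_ge0.
have SB : (S <= (B * normJ f ^+ 2)%:E)%E.
  by apply: esum_le_fsum => F _; rewrite -(normJ_symmetry hK f).
(* Finiteness makes the sum a real number, to which [cP] applies. *)
have Sfin : S \is a fin_num.
  by rewrite ge0_fin_numE// (le_lt_trans SB)// ltry.
have aPf := aP _ Tf.
have sf : s * complex.Re (br f f) <= normJ f ^+ 2.
  by rewrite (le_trans (ler_norm _))// normrM s1 mul1r (form_self_le hK).
apply/andP; split.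
  rewrite -(fineK Sfin) lee_fin.
  apply: (@le_trans _ _ (c * normJ f ^+ 2)); first by rewrite ler_pM2l.
  apply: cP => // F FA; rewrite -lee_fin fineK//; exact: fsum_le_esum.
rewrite (le_trans SB)// lee_fin.
(* Uniform definiteness enters as [normJ f ^+ 2 <= a^-1 * (s * [f, f])]. *)
apply: (@le_trans _ _ (B / a * (s * complex.Re (br f f)))).
  by rewrite mulrAC ler_pdivlMr// -mulrA ler_pM2l// mulrC.
rewrite ler_wpM2r ?le_max ?lexx ?orbT//.
by rewrite (le_trans _ aPf)// mulr_ge0 ?sqr_ge0// ltW.
Qed.

End FrameBounds.

Theorem theorem2p3 (R : realType) (V : completeNormedModType R[i])
    (br : {hermitian V for false & (@Num.conj R[i])}) (J : V -> V)
    (hK : krein_space_with_symmetry br J)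
    (I : choiceType) (W : I -> set V) (v : I -> R)
    (hW : J_fusion_frame br J W v) :
  exists Bm Am Ap Bp : R,
    [/\ [/\ Bm <= Am, Am < 0, 0 < Ap & Ap <= Bp],
        forall f : V, Mpos br W f ->
          ((Ap * complex.Re (br f f))%:E
             <= \esum_(i in Ipos br W)
                  (v i ^+ 2 * complex.Re `|br (piJ br J (W i) (J f)) f|)%:E
             <= (Bp * complex.Re (br f f))%:E)%E &
        forall f : V, Mneg br W f ->
          ((Am * complex.Re (br f f))%:E
             <= \esum_(i in Ineg br W)
                  (v i ^+ 2 * complex.Re `|br (piJ br J (W i) (J f)) f|)%:E
             <= (Bm * complex.Re (br f f))%:E)%E].
Proof.
case: hW => hWv _ hB maxp maxn.
have [subp clp up] := maximal_uniform hK (normr1 R) (unif_J_positiveP (br := br)) maxp.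
have [subn cln un] := maximal_uniform hK (normrN1 R) (unif_J_negativeP (br := br)) maxn.
have [cp [Cp [cp0 cpC hp]]] :=
  fusion_frame_bounds hK hWv (normr1 R) hB subp clp up.
have [cn [Cn [cn0 cnC hn]]] :=
  fusion_frame_bounds hK hWv (normrN1 R) hB subn cln un.
(* For [s = -1] the constants multiply [- [f, f]]; their negatives serve for [[f, f]], in reversed
   order. *)
exists (- Cn), (- cn), cp, Cp; split.
- by split=> //; [rewrite lerN2|rewrite oppr_lt0].
- by move=> f /hp; rewrite mul1r.
- by move=> f /hn; rewrite mulN1r !mulrN -!mulNr.
Qed.
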